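(* Let $f\colon[0,1]\times\mathbb R\to\mathbb R$ be continuous, and let $A,B\colon[0,1]\to\mathbb R$ be of bounded variation with $\operatorname{var}_{[0,1]}A+\operatorname{var}_{[0,1]}(A-B)<1$. Then there exists $\lambda_0>0$ such that for every $\lambda\in\mathbb R$ with $|\lambda|\le\lambda_0$ the boundary value problem $x''(t)=-\lambda f(t,x(t))$, $t\in[0,1]$, $x(0)=\int_0^1x(s)\,dA(s)$, $x(1)=\int_0^1x(s)\,dB(s)$ has a solution.
   Context: $\operatorname{var}_{[0,1]}$ is the Jordan variation; integrals in the boundary conditions are Riemann–Stieltjes integrals; a solution is a twice continuously differentiable $x\colon[0,1]\to\mathbb R$ satisfying the equation and the boundary conditions. *)

(* Defs.v *)
From HB Require Import structures.
From mathcomp Require Import all_boot all_order all_algebra.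
From mathcomp Require Import all_classical all_reals all_analysis.
Set Implicit Arguments. Unset Strict Implicit. Unset Printing Implicit Defensive.
Import Order.TTheory GRing.Theory Num.Theory.
Import numFieldNormedType.Exports.
Local Open Scope classical_set_scope.
Local Open Scope ring_scope.

Section Defs.
Context {R : realType}.

(* Riemann-Stieltjes sum of g w.r.t. F for the partition a = p_0 < p_1 < ... < p_n = b,
   represented (as in MathComp-Analysis' [itv_partition]) by s = [:: p_1; ...; p_n],
   with tags xi = [:: xi_1; ...; xi_n]. *)
Definition RS_sum (a b : R) (g F : R -> R) (s xi : seq R) : R :=
  \sum_(0 <= i < size s)
     g (nth b xi i) * (F (nth b (a :: s) i.+1) - F (nth b (a :: s) i)).

Definition tagged_partition (a b : R) (s xi : seq R) : Prop :=
  itv_partition a b s /\ size xi = size s /\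
  forall i, (i < size s)%N ->
    nth b (a :: s) i <= nth b xi i <= nth b (a :: s) i.+1.

Definition mesh_lt (a b : R) (s : seq R) (d : R) : Prop :=
  forall i, (i < size s)%N -> nth b (a :: s) i.+1 - nth b (a :: s) i < d.

Definition RS_integral (a b : R) (g F : R -> R) (I : R) : Prop :=
  forall e : R, 0 < e -> exists2 d : R, 0 < d &
    forall s xi, tagged_partition a b s xi -> mesh_lt a b s d ->
      `|RS_sum a b g F s xi - I| < e.

Definition deriv_on01 (x x' : R -> R) : Prop :=
  forall t, 0 <= t <= 1 ->
    (fun u => (x u - x t) / (u - t)) @ (within [set u : R | 0 <= u <= 1] (nbhs t^'))
      --> x' t.

Definition is_solution (f : R -> R -> R) (A B : R -> R) (lambda : R) (x : R -> R) : Prop :=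
  exists x1 x2 : R -> R,
    [/\ deriv_on01 x x1, deriv_on01 x1 x2,
        {within `[0, 1], continuous x2},
        (forall t, 0 <= t <= 1 -> x2 t = - lambda * f t (x t)) &
        (RS_integral 0 1 x A (x 0) /\ RS_integral 0 1 x B (x 1))].

End Defs.

(* Main.v *)
(** After [f] is clamped to the strip [|x| <= 1] it is bounded by some [K], and for
    small [lambda] the discrete problem given by the explicit Euler scheme with [n+1]
    steps and initial data [x(0) = a], [x'(0) = c] is a self-map
    [(a, c) |-> (S_A, a + c - x(1) - S_(A-B))] of a rectangle, [S_F] being the
    Riemann-Stieltjes sum of the scheme.  Only two parameters occur, so Sperner's
    lemma in the plane gives approximate fixed points.  The schemes are equi-Lipschitz
    together with their velocities, and their pointwise limit along a nonprincipal
    ultrafilter is twice differentiable, with both derivatives read off from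
    first-order expansions that pass to the limit.  The boundary conditions survive
    because Stieltjes sums over two fine partitions are close when the integrands
    are. *)
Require Import Defs.
From HB Require Import structures.
From mathcomp Require Import all_boot all_order all_algebra.
From mathcomp Require Import all_classical all_reals all_analysis.
From mathcomp Require Import ring lra zify.
Import Order.TTheory GRing.Theory Num.Theory.
Import numFieldNormedType.Exports.
Local Open Scope classical_set_scope.
Local Open Scope ring_scope.

Set Implicit Arguments.
Unset Strict Implicit.
Unset Printing Implicit Defensive.

(** * Comparison of Stieltjes sums over two partitions *)

Section stieltjes_comparison.
Variable R : realType.
Implicit Types (F T : R -> R) (p q : nat -> R) (u v : nat -> R).

(** The increment of [(s, t) |-> F (min s t)] over the rectangle [[a, b] x [c, d]]. For intervals
    that overlap it is the increment of [F] over their intersection. In this form it telescopes in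
    either interval without case analysis. *)
Definition overlap_increment F (a b c d : R) : R :=
  F (Num.min b d) - F (Num.min a d) - (F (Num.min b c) - F (Num.min a c)).

Lemma sum_overlap_increment F q n (a b : R) : q 0%N <= a -> a <= b -> b <= q n ->
  \sum_(0 <= j < n) overlap_increment F a b (q j) (q j.+1) = F b - F a.
Proof.
move=> qa ab bq; under eq_bigr do rewrite /overlap_increment.
rewrite (telescope_sumr (fun j => F (Num.min b (q j)) - F (Num.min a (q j)))) //.
have qb := le_trans qa ab; have aq := le_trans ab bq.
by rewrite (min_l bq) (min_l aq) (min_r qa) (min_r qb) subrr subr0.
Qed.

Lemma overlap_incrementC F (a b c d : R) :
  overlap_increment F a b c d = overlap_increment F c d a b.
Proof.
rewrite /overlap_increment (minC b d) (minC a d) (minC b c) (minC a c); ring.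
Qed.

Lemma overlap_increment_eq0 F (a b c d : R) : a <= b -> c <= d ->
  (b <= c) || (d <= a) -> overlap_increment F a b c d = 0.
Proof.
move=> ab cd /orP[bc|da]; rewrite /overlap_increment.
  have [ac [bd ad]] : a <= c /\ b <= d /\ a <= d by lra.
  by rewrite (min_l bc) (min_l ac) (min_l bd) (min_l ad) subrr.
have [ca [db cb]] : c <= a /\ d <= b /\ c <= b by lra.
by rewrite (min_r da) (min_r ca) (min_r db) (min_r cb) !subrr.
Qed.

Lemma overlap_increment_max F (a b c d : R) : a <= b -> c <= d ->
  a < d -> c < b ->
  overlap_increment F a b c d = F (Num.min b d) - F (Num.max a c).
Proof.
move=> ab cd ad cb; rewrite /overlap_increment.
rewrite (min_l (ltW ad)) (min_r (ltW cb)).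
by case: (leP a c) => ac; ring.
Qed.

Lemma normr_overlap_increment_le F T (l r a b c d : R) :
  (forall x y, l <= x -> x <= y -> y <= r -> `|F y - F x| <= T y - T x) ->
  l <= a -> a <= b -> b <= r -> c <= d ->
  `|overlap_increment F a b c d| <= overlap_increment T a b c d.
Proof.
move=> FT la ab br cd.
case: (leP b c) => bc.
  by rewrite !overlap_increment_eq0 ?bc ?normr0.
case: (leP d a) => da.
  by rewrite !overlap_increment_eq0 ?da ?orbT ?normr0.
rewrite !overlap_increment_max //; apply: FT.
- by rewrite le_max la.
- by rewrite ge_max !le_min ab (ltW bc) cd (ltW da).
- by rewrite ge_min br.
Qed.

(* Both sums are expanded over the overlaps of the two partitions, which
   replaces the choice of a common refinement. *)
Lemma stieltjes_sum_compare F T p q u v m n (l r w : R) :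
  (forall x y, l <= x -> x <= y -> y <= r -> `|F y - F x| <= T y - T x) ->
  p 0%N = l -> p m = r -> q 0%N = l -> q n = r ->
  (forall i, (i < m)%N -> l <= p i /\ p i <= p i.+1 /\ p i.+1 <= r) ->
  (forall j, (j < n)%N -> l <= q j /\ q j <= q j.+1 /\ q j.+1 <= r) ->
  (forall i j, (i < m)%N -> (j < n)%N -> p i < q j.+1 -> q j < p i.+1 ->
     `|u i - v j| <= w) ->
  `|\sum_(0 <= i < m) u i * (F (p i.+1) - F (p i)) -
    \sum_(0 <= j < n) v j * (F (q j.+1) - F (q j))| <= w * (T r - T l).
Proof.
move=> FT p0 pm q0 qn pmon qmon uv.
have -> : \sum_(0 <= i < m) u i * (F (p i.+1) - F (p i)) =
    \sum_(0 <= i < m) \sum_(0 <= j < n)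
       u i * overlap_increment F (p i) (p i.+1) (q j) (q j.+1).
  apply: eq_big_nat => i /andP[_ im]; rewrite -mulr_sumr.
  by have [? [? ?]] := pmon _ im; rewrite sum_overlap_increment ?q0 ?qn.
have -> : \sum_(0 <= j < n) v j * (F (q j.+1) - F (q j)) =
    \sum_(0 <= i < m) \sum_(0 <= j < n)
       v j * overlap_increment F (p i) (p i.+1) (q j) (q j.+1).
  rewrite exchange_big_nat; apply: eq_big_nat => j /andP[_ jn]; rewrite -mulr_sumr.
  have [? [? ?]] := qmon _ jn.
  under [in RHS]eq_bigr do rewrite overlap_incrementC.
  by rewrite sum_overlap_increment ?p0 ?pm.
(* The bound is expanded over the same overlaps, which reduces the claim to one overlap at a
   time. *)
have -> : w * (T r - T l) = \sum_(0 <= i < m) \sum_(0 <= j < n)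
    w * overlap_increment T (p i) (p i.+1) (q j) (q j.+1).
  under eq_bigr do rewrite -mulr_sumr.
  rewrite -mulr_sumr; congr (_ * _).
  rewrite -[in LHS]p0 -[in LHS]pm -(telescope_sumr (fun i => T (p i))) //.
  apply: eq_big_nat => i /andP[_ im].
  by have [? [? ?]] := pmon _ im; rewrite sum_overlap_increment ?q0 ?qn.
rewrite -sumrB; apply: (le_trans (ler_norm_sum _ _ _)).
rewrite big_nat_cond [leRHS]big_nat_cond; apply: ler_sum => i /andP[/andP[_ im] _].
rewrite -sumrB; apply: (le_trans (ler_norm_sum _ _ _)).
rewrite big_nat_cond [leRHS]big_nat_cond; apply: ler_sum => j /andP[/andP[_ jn] _].
have [? [pp ?]] := pmon _ im; have [? [qq ?]] := qmon _ jn.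
rewrite -mulrBl normrM.
case: (leP (p i.+1) (q j)) => bc.
  by rewrite !overlap_increment_eq0 ?bc ?normr0 ?mulr0.
case: (leP (q j.+1) (p i)) => da.
  by rewrite !overlap_increment_eq0 ?da ?orbT ?normr0 ?mulr0.
apply: ler_pM => //; first exact: uv.
exact: (@normr_overlap_increment_le _ _ l r).
Qed.

End stieltjes_comparison.

(** * Sperner's lemma on a square grid *)

Section sperner.

Let e (x y : nat) := ((x == 0%N) && (y == 1%N)) || ((x == 1%N) && (y == 0%N)).

(** If colour 2 is missing, the closed walk [x, y, t, z] switches between 0 and 1 an even number of
    times; if 0 or 1 is missing, no edge carries both. *)
Let e_cycle_even (x y z t k : nat) :
  (k < 3)%N -> all (fun c => (c < 3)%N && (c != k)) [:: x; y; z; t] ->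
  e x y (+) e z t = e x z (+) e y t.
Proof.
by case: k => [|[|[|//]]] _;
  case: x => [|[|[|?]]] //=; case: y => [|[|[|?]]] //=;
  case: z => [|[|[|?]]] //=; case: t => [|[|[|?]]].
Qed.

(* The edges of the grid [0, n]^2 with end colours 0 and 1 are counted mod 2:
   a boundary cycle has evenly many of them as soon as a colour is missing in
   every cell, while the sides [i = 0], [i = n], [j = n] have none and the side
   [j = 0] has an odd number. *)
Lemma sperner_grid (n : nat) (col : nat -> nat -> nat) :
  (forall i j, (col i j < 3)%N) ->
  (forall j, (j <= n)%N -> col 0%N j <> 1%N) ->
  (forall i, (i <= n)%N -> col i 0%N <> 2%N) ->
  (forall j, (j <= n)%N -> col n j = 1%N) ->
  (forall i, (i <= n)%N -> col i n <> 0%N) ->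
  exists i j : nat, [/\ (i < n)%N, (j < n)%N &
    forall k, (k < 3)%N -> exists i' j' : nat,
      [/\ (i <= i' <= i.+1)%N, (j <= j' <= j.+1)%N & col i' j' = k]].
Proof.
move=> c3 left bottom right top; apply: contrapT => none.
have cell i j : (i < n)%N -> (j < n)%N ->
    e (col i j) (col i.+1 j) (+) e (col i j.+1) (col i.+1 j.+1) =
    e (col i j) (col i j.+1) (+) e (col i.+1 j) (col i.+1 j.+1).
  move=> ltin ltjn.
  have [k k3 miss] : exists2 k, (k < 3)%N & forall i' j',
      (i <= i' <= i.+1)%N -> (j <= j' <= j.+1)%N -> col i' j' != k.
    apply: contrapT => full; apply: none; exists i, j; split => // k k3.
    apply: contrapT => nok; apply: full; exists k => // i' j' ii' jj'.
    by apply/eqP => ck; apply: nok; exists i', j'.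
  apply: (e_cycle_even k3) => /=.
  by rewrite !c3 !miss ?leqnn ?leqnSn.
pose H m j := \big[addb/false]_(0 <= i < m) e (col i j) (col i.+1 j).
(* Summing the cells of a strip cancels its inner vertical edges, so only the two outermost
   remain. *)
have Hrow m j : (m <= n)%N -> (j < n)%N ->
    H m j (+) H m j.+1 = e (col 0%N j) (col 0%N j.+1) (+) e (col m j) (col m j.+1).
  move=> + jn; elim: m => [|m IH] mn; first by rewrite /H !big_geq // !addbb.
  rewrite /H !big_nat_recr //= -[\big[_/_]_(0 <= i < m) e (col i j) _]/(H m j) -[\big[_/_]_(0 <= i < m) _]/(H m j.+1).
  have := IH (ltnW mn); have := cell _ _ mn jn.
  case: (H m j); case: (H m j.+1); case: (e (col m j) (col m.+1 j));
    case: (e (col m j.+1) _); case: (e (col m j) _);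
    case: (e (col m.+1 j) _); case: (e _ _) => //.

have eN1 x y : x <> 1%N -> y <> 1%N -> e x y = false.
  by rewrite /e => /eqP/negPf -> /eqP/negPf ->; rewrite andbF.
have eN0 x y : x <> 0%N -> y <> 0%N -> e x y = false.
  by rewrite /e => /eqP/negPf -> /eqP/negPf ->; rewrite andbF.
have Hn j : (j <= n)%N -> H n j = H n 0%N.
  elim: j => // j IH jn; rewrite -IH ?(ltnW jn) //.
  have := Hrow n j (leqnn _) jn.
  rewrite (eN1 _ _ (left _ (ltnW jn)) (left _ jn)).
  rewrite (right _ (ltnW jn)) (right _ jn) /=.
  by case: (H n j); case: (H n j.+1).
have Hnn : H n n = false.
  rewrite /H big_nat_cond big1 // => i /andP[/andP[_ lin] _].
  by apply: eN0; apply: top; [exact: ltnW|].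
(* The bottom row starts with colour 0 and uses only 0 and 1, so the parity of its switches tells
   the current colour. At [m = n] this colour is 1, against the even parity of the top row. *)
have Hb m : (m <= n)%N -> H m 0%N = (col m 0%N == 1%N).
  elim: m => [|m IHm] mn.
    by rewrite /H big_geq //; apply/esym/eqP/left.
  rewrite /H big_nat_recr //= -/(H m 0%N) IHm ?(ltnW mn) // /e.
  have := bottom _ mn; have := bottom _ (ltnW mn).
  move: (c3 m 0%N) (c3 m.+1 0%N).
  by case: (col m _) => [|[|[|?]]] //; case: (col m.+1 _) => [|[|[|?]]].
by have := Hb n (leqnn n); rewrite -(Hn n) // Hnn right.
Qed.

End sperner.

(** * Approximate fixed points of self-maps of a rectangle *)

Section approximate_fixed_point.
Variable R : realType.

Definition ucont2 (F : R -> R -> R) := forall e : R, 0 < e -> exists2 d : R, 0 < d &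
  forall a b a' b' : R, `|a - a'| <= d -> `|b - b'| <= d -> `|F a b - F a' b'| <= e.

Lemma exists_small_inverse (e : R) : 0 < e -> exists n : nat, n.+1%:R^-1 <= e.
Proof.
move=> e0; have [n _] := @near_infty_natSinv_lt R (PosNum e0).
by move/(_ n (leqnn n)) => /= /ltW ?; exists n.
Qed.

Lemma normr_natB_le1 (i i' k : nat) :
  (k <= i <= k.+1)%N -> (k <= i' <= k.+1)%N -> `|i%:R - i'%:R| <= 1 :> R.
Proof.
move=> ki ki'.
have [->|->] : i = k \/ i = k.+1 by lia.
  have [->|->] : i' = k \/ i' = k.+1 by lia.
    by rewrite subrr normr0.
  by rewrite -natr1 opprD addNKr normrN1.
have [->|->] : i' = k \/ i' = k.+1 by lia.
  by rewrite -natr1 addrAC subrr add0r normr1.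
by rewrite subrr normr0.
Qed.

(** Grid vertices are coloured by the signs of the displacements [F a b - a] and [G a b - b]. In a
    cell with all three colours each displacement takes both signs, up to zero, so uniform
    continuity makes both small. *)
Lemma approximate_fixed_point (F G : R -> R -> R) (r s : R) :
  0 <= r -> 0 <= s -> ucont2 F -> ucont2 G ->
  (forall a b : R, `|a| <= r -> `|b| <= s -> `|F a b| <= r /\ `|G a b| <= s) ->
  forall e : R, 0 < e -> exists a b : R,
    [/\ `|a| <= r, `|b| <= s, `|F a b - a| <= e & `|G a b - b| <= e].
Proof.
move=> r0 s0 ucF ucG self e e0.
have [d1 d10 Fd] := ucF (e / 2) ltac:(lra).
have [d2 d20 Gd] := ucG (e / 2) ltac:(lra).
(* A displacement varies inside a cell by at most [e / 2] from the map and [d <= e / 2] from the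
   coordinate. *)
pose d : R := Num.min (Num.min d1 d2) (e / 2).
have d_gt0 : 0 < d by rewrite !lt_min d10 d20; lra.
have [dd1 dd2 de] : [/\ d <= d1, d <= d2 & d <= e / 2].
  by rewrite /d; split; rewrite ?ge_min ?lexx ?orbT.
(* The mesh sizes are [2 * r / n] and [2 * s / n]; the summand 1 covers [r = s = 0]. *)
have K0 : 0 < 2 * (r + s + 1) by lra.
have [m hm] := exists_small_inverse (divr_gt0 d_gt0 K0).
pose n := m.+1.
have n0 : 0 < n%:R :> R by rewrite ltr0n.
have nK : 2 * (r + s + 1) <= d * n%:R.
  by move: hm; rewrite ler_pdivlMr // -[_^-1]div1r mulrAC mul1r ler_pdivrMr //.
pose p (t : R) (i : nat) := - t + 2 * t * i%:R / n%:R.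
have p0 t : p t 0%N = - t by rewrite /p mulr0 mul0r addr0.
have pn t : p t n = t by rewrite /p mulfK ?gt_eqF //; ring.
have pb (t : R) i : 0 <= t -> (i <= n)%N -> `|p t i| <= t.
  move=> t0 iN; have iN' : i%:R / n%:R <= 1 :> R.
    by rewrite ler_pdivrMr // mul1r ler_nat.
  have i0 : 0 <= i%:R / n%:R :> R by rewrite divr_ge0.
  rewrite /p -mulrA ler_norml; apply/andP; split; nra.
have pd (t : R) i i' k : 0 <= t -> t <= r + s + 1 -> (k <= i <= k.+1)%N ->
    (k <= i' <= k.+1)%N -> `|p t i - p t i'| <= d.
  move=> t0 tK ki ki'.
  have -> : p t i - p t i' = 2 * t * (i%:R - i'%:R) / n%:R.
    by rewrite /p; field; rewrite gt_eqF.
  rewrite normrM normfV (gtr0_norm n0) ler_pdivrMr // normrM.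
  apply: le_trans nK; rewrite ger0_norm; last lra.
  have := normr_natB_le1 ki ki'; move: (normr_ge0 (i%:R - i'%:R : R)).
  set q := `|i%:R - i'%:R|; clear -t0 tK => q0 q1.
  by apply: (@le_trans _ _ (2 * t)); [rewrite ler_piMr//; lra | lra].
pose gF i j := F (p r i) (p s j) - p r i.
pose gG i j := G (p r i) (p s j) - p s j.
(* Colours 1 and 2 mean a decreasing first or second coordinate. They are forced at [i = n] and
   [j = n] to meet the side conditions of Sperner's lemma; there the displacement is nonpositive
   anyway, by the self-map property. *)
pose col i j := if (n <= i)%N || (gF i j < 0) then 1%N else
  if (n <= j)%N || (gG i j < 0) then 2%N else 0%N.
have sF i j : (i <= n)%N -> (j <= n)%N ->
    `|F (p r i) (p s j)| <= r /\ `|G (p r i) (p s j)| <= s.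
  by move=> iN jN; apply: self; apply: pb.
have [|j jN|i iN|j jN|i iN|i [j [iN jN cell]]] := @sperner_grid n col.
- by move=> i j; rewrite /col; case: ifP => // _; case: ifP.
- have [] := sF 0%N j isT jN; rewrite ler_norml => /andP[h _] _.
  rewrite /col; case: ifP => [/orP[//|]|_]; last by case: ifP.
  by move: h; rewrite /gF p0 => ? ?; exfalso; lra.
- have [_] := sF i 0%N iN isT; rewrite ler_norml => /andP[h _].
  rewrite /col; case: ifP => // _; case: ifP => // /orP[//|].
  by move: h; rewrite /gG p0 => ? ?; exfalso; lra.
- by rewrite /col leqnn.
- by rewrite /col leqnn /=; case: ifP.
have [i0 [j0 [i0i j0j c0]]] := cell 0%N isT.
have [i1 [j1 [i1i j1j c1]]] := cell 1%N isT.
have [i2 [j2 [i2i j2j c2]]] := cell 2%N isT.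
have inN k k' : (k < n)%N -> (k <= k' <= k.+1)%N -> (k' <= n)%N.
  by move=> kn /andP[_ /leq_trans]; exact.
have gF0 : 0 <= gF i0 j0 /\ 0 <= gG i0 j0.
  move: c0; rewrite /col; case: ifP => // /norP[_].
  by case: ifP => // /norP[_]; rewrite -!leNgt.
have gF1 : gF i1 j1 <= 0.
  move: c1; rewrite /col; case: ifP => [/orP[n1 _|/ltW //]|_]; last by case: ifP.
  have i1n : i1 = n by apply/eqP; rewrite eqn_leq n1 (inN i).
  have [h _] := sF i1 j1 (inN _ _ iN i1i) (inN _ _ jN j1j).
  by move: h; rewrite /gF i1n pn ler_norml => /andP[_]; lra.
have gG2 : gG i2 j2 <= 0.
  move: c2; rewrite /col; case: ifP => // _.
  case: ifP => // /orP[n1 _|/ltW //].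
  have j2n : j2 = n by apply/eqP; rewrite eqn_leq n1 (inN j).
  have [_ h] := sF i2 j2 (inN _ _ iN i2i) (inN _ _ jN j2j).
  by move: h; rewrite /gG j2n pn ler_norml => /andP[_]; lra.
have rK : r <= r + s + 1 by lra.
have sK : s <= r + s + 1 by lra.
have h1 := Fd _ _ _ _ (le_trans (pd r _ _ _ r0 rK i0i i1i) dd1)
  (le_trans (pd s _ _ _ s0 sK j0j j1j) dd1).
have h2 := Gd _ _ _ _ (le_trans (pd r _ _ _ r0 rK i0i i2i) dd2)
  (le_trans (pd s _ _ _ s0 sK j0j j2j) dd2).
have h3 := pd r _ _ _ r0 rK i0i i1i.
have h4 := pd s _ _ _ s0 sK j0j j2j.
(* At the vertex of colour 0 both displacements are nonnegative, and the other two vertices bound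
   them above by [e]. *)
exists (p r i0), (p s j0); split.
- exact: pb (inN _ _ iN i0i).
- exact: pb (inN _ _ jN j0j).
- rewrite -/(gF i0 j0) ger0_norm; last by case: gF0.
  by move: gF1 h1 h3; rewrite /gF !ler_norml => ? /andP[_ ?] /andP[? ?]; lra.
- rewrite -/(gG i0 j0) ger0_norm; last by case: gF0.
  by move: gG2 h2 h4; rewrite /gG !ler_norml => ? /andP[_ ?] /andP[? ?]; lra.
Qed.

End approximate_fixed_point.

(** * The explicit Euler scheme and its one-sided estimates *)

Section euler_scheme.
Variables (R : realType) (phi : R -> R -> R).
Implicit Types h a c : R.

Fixpoint euler h a c (k : nat) : R * R :=
  if k is k'.+1 then
    let p := euler h a c k' in
    (p.1 + h * p.2, p.2 + h * phi (k'%:R * h) p.1)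
  else (a, c).

Definition euler_pos h a c k := (euler h a c k).1.
Definition euler_vel h a c k := (euler h a c k).2.

Lemma ucont2D (F G : R -> R -> R) : ucont2 F -> ucont2 G ->
  ucont2 (fun a b => F a b + G a b).
Proof.
move=> ucF ucG e e0; have e2 : 0 < e / 2 by rewrite divr_gt0.
have [d1 d10 Fd] := ucF _ e2; have [d2 d20 Gd] := ucG _ e2.
exists (Num.min d1 d2); first by rewrite lt_min d10 d20.
move=> a b a' b'; rewrite !le_min => /andP[a1 a2] /andP[b1 b2].
rewrite (splitr e) opprD addrACA (le_trans (ler_normD _ _)) // lerD //.
  exact: Fd.
exact: Gd.
Qed.

Lemma ucont2M (F : R -> R -> R) (k : R) : ucont2 F -> ucont2 (fun a b => k * F a b).
Proof.
move=> ucF e e0; have k0 : 0 < `|k| + 1 by rewrite ltr_wpDl.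
have [d d0 Fd] := ucF _ (divr_gt0 e0 k0); exists d => // a b a' b' aa bb.
rewrite -mulrBr normrM; have := Fd _ _ _ _ aa bb.
rewrite ler_pdivlMr //; apply: le_trans.
by rewrite mulrC ler_wpM2l // lerDl.
Qed.

Lemma ucont2_comp (t : R) (F : R -> R -> R) : ucont2 phi -> ucont2 F ->
  ucont2 (fun a b => phi t (F a b)).
Proof.
move=> uphi ucF e e0; have [d d0 phid] := uphi _ e0.
have [d' d'0 Fd] := ucF _ d0; exists d' => // a b a' b' aa bb.
by apply: phid; [rewrite subrr normr0 ltW|exact: Fd].
Qed.

Lemma ucont2_euler h k : ucont2 phi ->
  ucont2 (fun a c => euler_pos h a c k) /\ ucont2 (fun a c => euler_vel h a c k).
Proof.
move=> uphi; rewrite /euler_pos /euler_vel; elim: k => [|k [IX IV]] /=.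
  by split => e e0; exists e => // a b a' b'.
split; apply: ucont2D => //; apply: ucont2M => //; exact: ucont2_comp.
Qed.

Variables (h a c M : R).
Hypotheses (h0 : 0 <= h) (phiM : forall t x, `|phi t x| <= M).
Local Notation X := (euler_pos h a c).
Local Notation V := (euler_vel h a c).

(** The velocity increment is exactly the sum of [h * phi] along the steps, so deviations of [phi]
    from [y] add up. The choice [y = 0] gives the Lipschitz bound, and [y = phi] at an end node the
    derivative of the limit velocity. *)
Lemma euler_velocity_linearization (y e : R) (k j : nat) :
  (forall i, (k <= i)%N -> (i < k + j)%N -> `|phi (i%:R * h) (X i) - y| <= e) ->
  `|V (k + j) - V k - j%:R * h * y| <= j%:R * h * e.
Proof.
elim: j => [|j IH] phie.
  by rewrite addn0 !mul0r subrr subrr normr0.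
rewrite addnS {1}/euler_vel /= -/(V _) -/(X _).
have -> : V (k + j) + h * phi ((k + j)%:R * h) (X (k + j)) - V k - j.+1%:R * h * y =
  (V (k + j) - V k - j%:R * h * y) + h * (phi ((k + j)%:R * h) (X (k + j)) - y).
  by rewrite -natr1; ring.
have -> : j.+1%:R * h * e = j%:R * h * e + h * e by rewrite -natr1; ring.
apply: (le_trans (ler_normD _ _)); apply: lerD.
  by apply: IH => i ki ij; apply: phie => //; rewrite addnS ltnW.
rewrite normrM ger0_norm // ler_wpM2l //; apply: phie; first exact: leq_addr.
by rewrite addnS.
Qed.

Lemma euler_velocity_lipschitz (k j : nat) : `|V (k + j) - V k| <= j%:R * h * M.
Proof.
have := @euler_velocity_linearization 0 M k j; rewrite mulr0 subr0; apply.
by move=> i _ _; rewrite subr0.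
Qed.

(** Step [j] adds the error [h * (V (k + j) - V k)], at most [j * h ^ 2 * M]; the growth of the
    square from [j] to [j + 1] absorbs it. *)
Lemma euler_position_linearization (k j : nat) :
  `|X (k + j) - X k - j%:R * h * V k| <= M * (j%:R * h) ^+ 2.
Proof.
have M0 : 0 <= M by apply: le_trans (phiM 0 0).
elim: j => [|j IH].
  by rewrite addn0 !mul0r subrr subrr normr0 expr0n mulr0.
rewrite addnS {1}/euler_pos /= -/(X _) -/(V _).
have -> : X (k + j) + h * V (k + j) - X k - j.+1%:R * h * V k =
  (X (k + j) - X k - j%:R * h * V k) + h * (V (k + j) - V k).
  by rewrite -natr1; ring.
apply: (le_trans (ler_normD _ _)).
apply: (@le_trans _ _ (M * (j%:R * h) ^+ 2 + h * (j%:R * h * M))).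
  apply: lerD => //.
  by rewrite normrM ger0_norm // ler_wpM2l // euler_velocity_lipschitz.
have -> : M * (j.+1%:R * h) ^+ 2 = M * (j%:R * h) ^+ 2 + h * (j%:R * h * M) +
   M * (h ^+ 2 * (j%:R + 1)) by rewrite -natr1; ring.
by rewrite lerDl mulr_ge0 // mulr_ge0 ?sqr_ge0 // addr_ge0.
Qed.

Lemma euler_velocity_bound (k : nat) : k%:R * h <= 1 -> `|V k| <= `|c| + M.
Proof.
move=> kh; have M0 : 0 <= M by apply: le_trans (phiM 0 0).
have := euler_velocity_lipschitz 0 k; rewrite add0n {2}/euler_vel /= => Vk.
rewrite -(subrK c (V k)) addrC (le_trans (ler_normD _ _)) // lerD2l.
by rewrite (le_trans Vk) // ler_piMl.
Qed.

(** The first bound controls the defect of the end position in the self-map property; the second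
    keeps the scheme in the strip where clamping does nothing. *)
Lemma euler_position_bound (k : nat) : k%:R * h <= 1 ->
  `|X k - a - k%:R * h * c| <= M /\ `|X k| <= `|a| + `|c| + M.
Proof.
move=> kh; have M0 : 0 <= M by apply: le_trans (phiM 0 0).
have kh0 : 0 <= k%:R * h by rewrite mulr_ge0.
have := euler_position_linearization 0 k; rewrite add0n {2}/euler_pos {1}/euler_vel /= => Xk.
have Xk1 : `|X k - a - k%:R * h * c| <= M.
  by rewrite (le_trans Xk) // ler_piMr // expr_le1.
split => //.
have -> : X k = (a + k%:R * h * c) + (X k - a - k%:R * h * c) by ring.
rewrite (le_trans (ler_normD _ _)) // lerD //.
rewrite (le_trans (ler_normD _ _)) // lerD2l normrM (ger0_norm kh0).
by rewrite ler_piMl.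
Qed.

Lemma euler_position_lipschitz (k j : nat) : (k + j)%:R * h <= 1 ->
  `|X (k + j) - X k| <= j%:R * h * (`|c| + M).
Proof.
elim: j => [|j IH] kh.
  by rewrite addn0 !mul0r subrr normr0.
have kjh : (k + j)%:R * h <= 1.
  by apply: le_trans kh; rewrite ler_wpM2r // ler_nat addnS.
rewrite addnS {1}/euler_pos /= -/(X _) -/(V _).
rewrite addrAC (le_trans (ler_normD _ _)) //.
have -> : j.+1%:R * h * (`|c| + M) = j%:R * h * (`|c| + M) + h * (`|c| + M).
  by rewrite -natr1; ring.
rewrite lerD ?IH // normrM ger0_norm // ler_wpM2l //; exact: euler_velocity_bound.
Qed.

End euler_scheme.

(** * Estimates between nodes in either order *)

Section euler_symmetric_estimates.
Variables (R : realType) (phi : R -> R -> R) (h a c M : R).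
Hypotheses (h0 : 0 <= h) (phiM : forall t x, `|phi t x| <= M).
Hypothesis acM : `|a| + `|c| + M <= 1.
Local Notation X := (euler_pos phi h a c).
Local Notation V := (euler_vel phi h a c).

Let diff_grid (k j : nat) : (k + j)%:R * h - k%:R * h = j%:R * h.
Proof. by rewrite natrD mulrDl addrAC subrr add0r. Qed.

Let jh0 (j : nat) : 0 <= j%:R * h.
Proof. by rewrite mulr_ge0. Qed.

Lemma euler_position_lipschitz_sym (k l : nat) :
  k%:R * h <= 1 -> l%:R * h <= 1 -> `|X l - X k| <= `|l%:R * h - k%:R * h|.
Proof.
wlog kl : k l / (k <= l)%N => [wlg kh lh|kh lh].
  have [kl|lk] := leqP k l; first exact: wlg.
  by rewrite distrC [leRHS]distrC; apply: wlg => //; exact: ltnW.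
rewrite -(subnKC kl) in lh *; rewrite diff_grid (ger0_norm (jh0 _)).
apply: (le_trans (euler_position_lipschitz a c h0 phiM lh)).
by rewrite ler_piMr //; move: acM (normr_ge0 a); lra.
Qed.

(** The factor 2 comes from expanding backwards: replacing the velocity at the earlier node by that
    at the later one costs a second [M * (j * h) ^ 2]. *)
Lemma euler_position_linearization_sym (k l : nat) :
  `|X l - X k - (l%:R * h - k%:R * h) * V k| <= 2 * M * (l%:R * h - k%:R * h) ^+ 2.
Proof.
have M0 : 0 <= M by apply: le_trans (phiM 0 0).
have [kl|lk] := leqP k l.
  rewrite -(subnKC kl) diff_grid.
  apply: (le_trans (euler_position_linearization _ _ h0 phiM _ _)).
  by rewrite -mulrA mulrDl mul1r lerDl mulr_ge0 ?sqr_ge0.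
rewrite -(subnKC (ltnW lk)); set j := (k - l)%N.
rewrite -[l%:R * h - _]opprB diff_grid sqrrN.
have -> : X l - X (l + j) - - (j%:R * h) * V (l + j) =
  - (X (l + j) - X l - j%:R * h * V l) + j%:R * h * (V (l + j) - V l) by ring.
have -> : 2 * M * (j%:R * h) ^+ 2 = M * (j%:R * h) ^+ 2 + j%:R * h * (j%:R * h * M)
  by ring.
apply: (le_trans (ler_normD _ _)); apply: lerD.
  by rewrite normrN; exact: euler_position_linearization.
rewrite normrM ger0_norm // ler_wpM2l //; exact: euler_velocity_lipschitz.
Qed.

(** Positions are 1-Lipschitz, so a time lag of at most [d] moves both arguments of [phi] by at most
    [d], and [phi] stays [e]-close to its value at node [k] on all steps in between. *)
Lemma euler_velocity_linearization_sym (d e : R) (k l : nat) :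
  (forall t x t' x' : R, `|t - t'| <= d -> `|x - x'| <= d ->
     `|phi t x - phi t' x'| <= e) ->
  k%:R * h <= 1 -> l%:R * h <= 1 -> `|l%:R * h - k%:R * h| <= d ->
  `|V l - V k - (l%:R * h - k%:R * h) * phi (k%:R * h) (X k)| <=
    e * `|l%:R * h - k%:R * h|.
Proof.
move=> phid kh lh kld.
have phie i : (i%:R * h <= 1) -> `|i%:R * h - k%:R * h| <= d ->
    `|phi (i%:R * h) (X i) - phi (k%:R * h) (X k)| <= e.
  move=> ih ik; apply: phid => //; apply: le_trans ik.
  exact: euler_position_lipschitz_sym.
have phi_le i : (k <= i)%N && (i <= l)%N || (l <= i)%N && (i <= k)%N ->
    `|phi (i%:R * h) (X i) - phi (k%:R * h) (X k)| <= e.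
  move=> /orP[]/andP[ki il]; apply: phie.
  - by apply: le_trans lh; rewrite ler_wpM2r // ler_nat.
  - apply: le_trans kld.
    rewrite !ger0_norm ?subr_ge0 ?ler_wpM2r ?ler_nat // ?(leq_trans ki) //.
    by rewrite lerD2r ler_wpM2r // ler_nat.
  - by apply: le_trans kh; rewrite ler_wpM2r // ler_nat.
  - apply: le_trans kld.
    rewrite !ler0_norm ?subr_le0 ?ler_wpM2r ?ler_nat // ?(leq_trans ki) //.
    by rewrite lerN2 lerD2r ler_wpM2r // ler_nat.
have [kl|lk] := leqP k l.
  have -> : l%:R * h - k%:R * h = (l - k)%:R * h by rewrite -[in LHS](subnKC kl) diff_grid.
  rewrite (ger0_norm (jh0 _)) [leRHS]mulrC -[in V l](subnKC kl).
  apply: euler_velocity_linearization => // i ki il.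
  by apply: phi_le; rewrite ki ltnW // -(subnKC kl).
have -> : l%:R * h - k%:R * h = - ((k - l)%:R * h).
  by rewrite -[in LHS](subnKC (ltnW lk)) -opprB diff_grid.
rewrite normrN (ger0_norm (jh0 _)) [leRHS]mulrC -normrN.
have -> : - (V l - V k - - ((k - l)%:R * h) * phi (k%:R * h) (X k)) =
  V k - V l - (k - l)%:R * h * phi (k%:R * h) (X k) by ring.
rewrite -[in V k](subnKC (ltnW lk)).
apply: euler_velocity_linearization => // i ki il.
by apply: phi_le; rewrite ki orbC ltnW // -(subnKC (ltnW lk)).
Qed.

End euler_symmetric_estimates.

(** * Limit of the schemes along an ultrafilter *)

Section euler_limit.
Variable R : realType.

(** Compactness of the segment gives a cluster point, and an ultrafilter converges to each of its
    cluster points. *)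
Lemma ultrafilter_bounded_cvg (U : set_system nat) (UU : UltraFilter U) (u : nat -> R)
  (K : R) : (\forall n \near U, `|u n| <= K) -> exists l : R, u n @[n --> U] --> l.
Proof.
move=> uK.
have uA : (u @ U) [set` `[- K, K]].
  by near=> n; rewrite /= in_itv /= -ler_norml; near: n.
have [l [_ cl]] := @segment_compact R (- K) K _ _ uA.
exists l => V Vl.
have [//|UnV] := in_ultra_setVsetC (u @^-1` V) UU.
have [z [/=]] : ~` V `&` V !=set0 by exact: cl.
by [].
Unshelve. all: by end_near. Qed.

Lemma natSinv_cvg0 (U : set_system nat) {FU : Filter U} : \oo `<=` U ->
  (n.+1%:R^-1 : R) @[n --> U] --> (0 : R).
Proof.
move=> ooU; apply/cvgrPdist_le => e e0; apply: ooU.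
have [m hm] := exists_small_inverse e0.
exists m => // n /= mn; rewrite sub0r normrN ger0_norm ?invr_ge0 //.
by apply: le_trans hm; rewrite lef_pV2 ?posrE ?ltr0n // ler_nat.
Qed.

Lemma ucont2_cvg (phi : R -> R -> R) (U : set_system nat) {FU : Filter U}
  (u v : nat -> R) (t x : R) : ucont2 phi ->
  u n @[n --> U] --> t -> v n @[n --> U] --> x ->
  phi (u n) (v n) @[n --> U] --> phi t x.
Proof.
move=> uphi ut vx; apply/cvgrPdist_le => e e0; have [d d0 phid] := uphi _ e0.
near=> n; apply: phid; near: n.
  by move/cvgrPdist_le : ut; apply.
by move/cvgrPdist_le : vx; apply.
Unshelve. all: by end_near. Qed.

Lemma distr_le_triangle (a b c e f K : R) :
  `|a - b| <= e -> `|b - c| <= f -> e + f <= K -> `|a - c| <= K.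
Proof.
move=> ab bc; apply: le_trans; rewrite (le_trans _ (lerD ab bc)) //.
by rewrite (le_trans _ (ler_normD _ _)) // addrA subrK.
Qed.

Variables (phi : R -> R -> R) (M : R) (a c : nat -> R).
Hypotheses (uphi : ucont2 phi) (phiM : forall t x, `|phi t x| <= M).
Hypothesis acM : forall n, `|a n| + `|c n| + M <= 1.

Let h (n : nat) : R := n.+1%:R^-1.
Let X n k := euler_pos phi (h n) (a n) (c n) k.
Let V n k := euler_vel phi (h n) (a n) (c n) k.
Let idx n (t : R) : nat := Num.truncn (n.+1%:R * t).
Let node n t : R := (idx n t)%:R * h n.

Let h_gt0 n : 0 < h n. Proof. by rewrite invr_gt0. Qed.
Let h_ge0 n : 0 <= h n. Proof. exact: ltW. Qed.

Let node_le n (t : R) : 0 <= t -> 0 <= node n t /\ node n t <= t.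
Proof.
move=> t0; split; first by rewrite mulr_ge0.
have /truncn_itv/andP[nt _] : 0 <= n.+1%:R * t by rewrite mulr_ge0.
by rewrite /node ler_pdivrMr ?ltr0n // mulrC.
Qed.

Let node_dist n (t : R) : 0 <= t -> `|t - node n t| <= h n.
Proof.
move=> t0; have [n0 nt] := node_le n t0.
rewrite ger0_norm ?subr_ge0 // lerBlDr.
have /truncn_itv/andP[_] : 0 <= n.+1%:R * t by rewrite mulr_ge0.
rewrite -(ltr_pM2r (h_gt0 n)) mulrAC /h mulfV ?pnatr_eq0 // mul1r -/(h n) => /ltW.
by rewrite -natr1 mulrDl mul1r addrC.
Qed.

Let node_le1 n (t : R) : 0 <= t <= 1 -> (idx n t)%:R * h n <= 1.
Proof. by case/andP => /(node_le n)[_ nt] t1; exact: le_trans t1. Qed.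

Let X_le1 n k : k%:R * h n <= 1 -> `|X n k| <= 1.
Proof.
by move=> kh; have [_ /le_trans] := euler_position_bound (a n) (c n) (h_ge0 n) phiM kh; apply.
Qed.

Let V_le1 n k : k%:R * h n <= 1 -> `|V n k| <= 1.
Proof.
move=> kh; apply: (le_trans (euler_velocity_bound (a n) (c n) (h_ge0 n) phiM kh)).
by move: (acM n) (normr_ge0 (a n)); lra.
Qed.

(** The first four properties are non-strict inequalities at the nodes below [s] and [t], hence pass
    to the limit. The last turns pointwise convergence into uniform closeness for some late [n], by
    equicontinuity. *)
Lemma euler_limit : exists x v : R -> R,
  [/\ forall s t : R, 0 <= s <= 1 -> 0 <= t <= 1 ->
        `|x s - x t - (s - t) * v t| <= 2 * M * (s - t) ^+ 2,
      forall e : R, 0 < e -> exists2 d : R, 0 < d & forall s t : R,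
        0 <= s <= 1 -> 0 <= t <= 1 -> `|s - t| <= d ->
        `|v s - v t - (s - t) * phi t (x t)| <= e * `|s - t|,
      forall t : R, 0 <= t <= 1 -> `|x t| <= 1,
      forall s t : R, 0 <= s <= 1 -> 0 <= t <= 1 -> `|x s - x t| <= `|s - t| &
      forall (e : R) (m : nat), 0 < e -> exists2 n, (m <= n)%N &
        forall k, (k <= n.+1)%N -> `|X n k - x (k%:R * h n)| <= e].
Proof.
have [U [UU ooU]] := ultraFilterLemma (@eventually_filter).
have UP : ProperFilter U by exact: ultra_proper.
have near_h (e : R) : 0 < e -> \forall n \near U, h n <= e.
  move=> e0; have hU : h n @[n --> U] --> (0 : R) by exact: natSinv_cvg0.
  move/cvgrPdist_le : hU => /(_ _ e0).
  by apply: filterS => n; rewrite sub0r normrN ger0_norm // h_ge0.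
(* The implication inside the existential makes the limit total in [t], as [choice] demands; outside
   [[0, 1]] it is the dummy value 0. *)
have hx (t : R) : exists l : R, 0 <= t <= 1 -> X n (idx n t) @[n --> U] --> l.
  have [t01|nt01] := pselect (0 <= t <= 1); last by exists 0 => /nt01.
  have [|l ll] := @ultrafilter_bounded_cvg U UU (fun n => X n (idx n t)) 1.
    by apply: nearW => n; apply: X_le1; exact: node_le1.
  by exists l.
have hv (t : R) : exists l : R, 0 <= t <= 1 -> V n (idx n t) @[n --> U] --> l.
  have [t01|nt01] := pselect (0 <= t <= 1); last by exists 0 => /nt01.
  have [|l ll] := @ultrafilter_bounded_cvg U UU (fun n => V n (idx n t)) 1.
    by apply: nearW => n; apply: V_le1; exact: node_le1.
  by exists l.
have [x xE] := choice hx; have [v vE] := choice hv.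
have nodeE (t : R) : 0 <= t -> node n t @[n --> U] --> t.
  move=> t0; apply/cvgrPdist_le => e e0; near=> n.
  apply: (le_trans (node_dist n t0)).
  by near: n; exact: near_h.
have lip (s t : R) : 0 <= s <= 1 -> 0 <= t <= 1 -> `|x s - x t| <= `|s - t|.
  move=> s01 t01; have /andP[s0 _] := s01; have /andP[t0 _] := t01.
  apply: (@ler_cvg_to _ U _ R (fun n => `|X n (idx n s) - X n (idx n t)|)
    (fun n => `|node n s - node n t|)).
  - by apply: cvg_norm; apply: cvgB; [exact: xE|exact: xE].
  - by apply: cvg_norm; apply: cvgB; exact: nodeE.
  - apply: nearW => n; apply: (euler_position_lipschitz_sym (h_ge0 n) phiM (acM n));
      exact: node_le1.
exists x, v; split => //.
- move=> s t s01 t01; have /andP[s0 _] := s01; have /andP[t0 _] := t01.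
  apply: (@ler_cvg_to _ U _ R
    (fun n => `|X n (idx n s) - X n (idx n t) - (node n s - node n t) * V n (idx n t)|)
    (fun n => 2 * M * (node n s - node n t) ^+ 2)).
  - apply: cvg_norm; apply: cvgB; first by apply: cvgB; [exact: xE|exact: xE].
    by apply: cvgM; [apply: cvgB; exact: nodeE|exact: vE].
  - apply: cvgM; first exact: cvg_cst.
    by under eq_fun do rewrite expr2; rewrite expr2;
      apply: cvgM; apply: cvgB; exact: nodeE.
  - by apply: nearW => n; exact: (euler_position_linearization_sym _ _ (h_ge0 n) phiM).
(* Halving [d] leaves a strict gap, so the distance of the nodes, which only tends to [s - t], is
   eventually at most [d]. *)
- move=> e e0; have [d d0 phid] := uphi e0; exists (d / 2); first by rewrite divr_gt0.
  move=> s t s01 t01 std; have /andP[s0 _] := s01; have /andP[t0 _] := t01.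
  have dnode : (node n s - node n t) @[n --> U] --> s - t by apply: cvgB; exact: nodeE.
  apply: (@ler_cvg_to _ U _ R
    (fun n => `|V n (idx n s) - V n (idx n t) -
       (node n s - node n t) * phi (node n t) (X n (idx n t))|)
    (fun n => e * `|node n s - node n t|)).
  - apply: cvg_norm; apply: cvgB; first by apply: cvgB; [exact: vE|exact: vE].
    by apply: cvgM => //; apply: ucont2_cvg => //; [exact: nodeE|exact: xE].
  - by apply: cvgM; [exact: cvg_cst|exact: cvg_norm].
  - have : \forall n \near U, `|node n s - node n t| <= d.
      have dlt : `|s - t| < d.
        by apply: le_lt_trans std _; rewrite ltr_pdivrMr // ltr_pMr // ltr1n.
      by apply: cvgr_norm_le dlt.
    apply: filterS => n nd.
    by apply: (euler_velocity_linearization_sym (h_ge0 n) phiM (acM n) phid) => //;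
      exact: node_le1.
- move=> t t01; apply: (@ler_cvg_to _ U _ R (fun n => `|X n (idx n t)|) (fun=> 1)).
  + by apply: cvg_norm; exact: xE.
  + exact: cvg_cst.
  + by apply: nearW => n; apply: X_le1; exact: node_le1.
move=> e m e0.
(* A fixed coarse grid of step at most [e / 4] is used. Two quarters of [e] pay for moving the
   scheme from node [k] to a coarse node, one for convergence there, and one for moving [x] back. *)
have e4 : 0 < e / 4 by rewrite divr_gt0.
have [p pe] := exists_small_inverse e4.
have grid01 j : (j <= p.+1)%N -> 0 <= j%:R * h p <= 1.
  by move=> jp; rewrite mulr_ge0 //= /h ler_pdivrMr ?ltr0n // mul1r ler_nat.
have near_grid q : (q <= p.+2)%N -> \forall n \near U, forall j, (j < q)%N ->
    `|X n (idx n (j%:R * h p)) - x (j%:R * h p)| <= e / 4.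
  elim: q => [|q IH] qp; first exact: nearW.
  have IH' := IH (ltnW qp).
  have /cvgrPdist_le/(_ _ e4) hq := xE _ (grid01 q qp).
  near=> n => j; rewrite ltnS leq_eqVlt => /predU1P[->|jq].
    by rewrite distrC; near: n.
  by move: j jq; near: n.
have [n [[mn hn] Xn]] : exists n, ((m <= n)%N /\ h n <= e / 4) /\ forall j, (j < p.+2)%N ->
    `|X n (idx n (j%:R * h p)) - x (j%:R * h p)| <= e / 4.
  apply: (@filter_ex _ U); apply: filterI; last exact: near_grid.
  by apply: filterI; [apply: ooU; exists m|exact: near_h].
exists n => // k kn; set t := k%:R * h n.
have t01 : 0 <= t <= 1.
  by rewrite /t mulr_ge0 //= /h ler_pdivrMr ?ltr0n // mul1r ler_nat.
have /andP[t0 t1] := t01.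
pose j := idx p t.
have jp : (j <= p.+1)%N.
  have := node_le1 p t01; rewrite /h ler_pdivrMr ?ltr0n // mul1r ler_nat.
  exact.
have j01 := grid01 _ jp; have /andP[j0 _] := j01.
have tj : `|t - j%:R * h p| <= e / 4 by apply: le_trans (node_dist p t0) pe.
have jn := node_dist n j0.
have Xkj : `|X n k - X n (idx n (j%:R * h p))| <= e / 4 + e / 4.
  apply: (@le_trans _ _ `|t - node n (j%:R * h p)|).
    apply: (euler_position_lipschitz_sym (h_ge0 n) phiM (acM n)).
      exact: node_le1.
    by case/andP : t01.
  by apply: (distr_le_triangle tj jn); rewrite lerD2l.
apply: (distr_le_triangle Xkj).
  apply: (distr_le_triangle (Xn _ _)); first by rewrite ltnS.
    by apply: (lip _ t).
  exact: lexx.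
by rewrite distrC; lra.
Unshelve. all: by end_near. Qed.

End euler_limit.

(** * Clamping the nonlinearity *)

Section clamped_field.
Variable R : realType.

Definition clamp (l r t : R) : R := Num.max l (Num.min r t).

Lemma clamp_itv (l r t : R) : l <= r -> l <= clamp l r t <= r.
Proof. by move=> lr; rewrite /clamp le_max lexx ge_max lr ge_min lexx. Qed.

Lemma clamp_id (l r t : R) : l <= t <= r -> clamp l r t = t.
Proof. by case/andP => lt tr; rewrite /clamp min_r // max_r. Qed.

Lemma clamp_lipschitz (l r s t : R) : `|clamp l r s - clamp l r t| <= `|s - t|.
Proof.
wlog st : s t / s <= t => [wlg|].
  by have [/wlg //|/ltW/wlg] := leP s t; rewrite distrC [leRHS]distrC.
rewrite distrC [leRHS]distrC !ger0_norm ?subr_ge0 //; last first.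
  by rewrite /clamp ge_max !le_max lexx /= le_min !ge_min lexx st !orbT.
rewrite lerBlDr /clamp ge_max addr_maxr le_max lerDr subr_ge0 st /=.
by rewrite le_max addr_minr le_min !ge_min subrK lexx orbT lerDr subr_ge0 st !orbT.
Qed.

Lemma within_continuous_cvg (T U : topologicalType) (S : set T) (F : T -> U)
  (G : set_system nat) {FG : Filter G} (u : nat -> T) (p : T) :
  {within S, continuous F} -> (forall n, S (u n)) -> S p ->
  u n @[n --> G] --> p -> F (u n) @[n --> G] --> F p.
Proof.
move=> cF Su Sp up W WFp.
have /= := cF p W WFp; rewrite /nbhs /= -nbhs_subspace_in // => WS.
have uS : G (u @^-1` [set q | S q -> (F @^-1` W) q]) by exact: up WS.
by apply: filterS uS => n; apply.
Qed.

Variable f : R -> R -> R.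
Hypothesis cf : {within [set p : R * R | 0 <= p.1 <= 1],
  continuous (fun p : R * R => f p.1 p.2)}.

(** Clamping the time as well gives a field on the whole plane that equals [f] on [[0, 1] x
    [-1, 1]]. *)
Definition clamped (t x : R) : R := f (clamp 0 1 t) (clamp (- 1) 1 x).

Let i01 t : 0 <= clamp 0 1 t <= 1. Proof. exact: clamp_itv. Qed.
Let i11 x : `|clamp (- 1) 1 x| <= 1.
Proof. by rewrite ler_norml clamp_itv //; lra. Qed.

(** Compactness of the rectangle in sequential form, the common source of uniform continuity and
    boundedness. *)
Lemma clamped_cvg (U : set_system nat) (UU : UltraFilter U) (t x : nat -> R) :
  exists s y : R, [/\ clamp 0 1 (t n) @[n --> U] --> s,
    clamp (- 1) 1 (x n) @[n --> U] --> y, 0 <= s <= 1 &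
    clamped (t n) (x n) @[n --> U] --> f s y].
Proof.
have UP : ProperFilter U by exact: ultra_proper.
have [|s ts] := @ultrafilter_bounded_cvg R U UU (fun n => clamp 0 1 (t n)) 1.
  by apply: nearW => n; have /andP[h1 h2] := i01 (t n); rewrite ger0_norm.
have [|y xy] := @ultrafilter_bounded_cvg R U UU (fun n => clamp (- 1) 1 (x n)) 1.
  by apply: nearW => n; exact: i11.
have s01 : 0 <= s <= 1.
  apply/andP; split.
    apply: (@ler_cvg_to _ U _ R (fun=> 0) (fun n => clamp 0 1 (t n))) => //.
      exact: cvg_cst.
    by apply: nearW => n; have /andP[] := i01 (t n).
  apply: (@ler_cvg_to _ U _ R (fun n => clamp 0 1 (t n)) (fun=> 1)) => //.
    exact: cvg_cst.
  by apply: nearW => n; have /andP[] := i01 (t n).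
exists s, y; split => //.
pose u n := (clamp 0 1 (t n), clamp (- 1) 1 (x n)).
have us : u n @[n --> U] --> (s, y).
  move=> W [[W1 W2] /= [sW1 yW2] W12].
  have h1 : \forall n \near U, W1 (clamp 0 1 (t n)) by exact: ts.
  have h2 : \forall n \near U, W2 (clamp (- 1) 1 (x n)) by exact: xy.
  have uW : \forall n \near U, W (u n).
    by apply: filterS (filterI h1 h2) => n [? ?]; apply: W12.
  exact: uW.
pose S := [set p : R * R | 0 <= p.1 <= 1].
have Su n : S (u n) by exact: i01.
have Sp : S (s, y) by [].
exact: (within_continuous_cvg cf Su Sp us).
Qed.

(** The Heine-Cantor argument: pairs of points that violate uniform continuity at scale
    [1 / (n + 1)] have a common limit along the ultrafilter, where the values cannot stay [e]
    apart. *)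
Lemma ucont2_clamped : ucont2 clamped.
Proof.
move=> e e0; apply: contrapT => nucont.
have bad n : exists p : (R * R) * (R * R),
    [/\ `|p.1.1 - p.2.1| <= n.+1%:R^-1, `|p.1.2 - p.2.2| <= n.+1%:R^-1 &
      e < `|clamped p.1.1 p.1.2 - clamped p.2.1 p.2.2|].
  apply: contrapT => nbad; apply: nucont; exists n.+1%:R^-1; first by rewrite invr_gt0.
  move=> a b a' b' aa bb; rewrite leNgt; apply/negP => eab.
  by apply: nbad; exists ((a, b), (a', b')).
have [p pP] := choice bad.
have [U [UU ooU]] := ultraFilterLemma (@eventually_filter).
have UP : ProperFilter U by exact: ultra_proper.
have [s [y [ts xy s01 fsy]]] :=
  clamped_cvg UU (fun n => (p n).1.1) (fun n => (p n).1.2).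
have [s' [y' [ts' xy' s01' fsy']]] :=
  clamped_cvg UU (fun n => (p n).2.1) (fun n => (p n).2.2).
have inv0 : (n.+1%:R^-1 : R) @[n --> U] --> (0 : R) by exact: natSinv_cvg0.
have same (u v : nat -> R) (l r : R) : (forall n, `|u n - v n| <= n.+1%:R^-1) ->
    u n @[n --> U] --> l -> v n @[n --> U] --> r -> l = r.
  move=> uv ul vr; apply/eqP; rewrite -subr_eq0 -normr_le0.
  apply: (@ler_cvg_to _ U _ R (fun n => `|u n - v n|) (fun n => n.+1%:R^-1)) => //.
    by apply: cvg_norm; exact: cvgB.
  exact: nearW.
have ss : s = s'.
  apply: same ts ts' => n; have [h _ _] := pP n.
  exact: le_trans (clamp_lipschitz _ _ _ _) h.
have yy : y = y'.
  apply: same xy xy' => n; have [_ h _] := pP n.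
  exact: le_trans (clamp_lipschitz _ _ _ _) h.
have : e <= `|f s y - f s' y'|.
  apply: (@ler_cvg_to _ U _ R (fun=> e) (fun n =>
    `|clamped (p n).1.1 (p n).1.2 - clamped (p n).2.1 (p n).2.2|)).
  - exact: cvg_cst.
  - by apply: cvg_norm; exact: cvgB.
  - by apply: nearW => n; have [_ _ /ltW] := pP n.
by rewrite ss yy subrr normr0 leNgt e0.
Qed.

Lemma clamped_bounded : exists2 K : R, 0 < K & forall t x, `|clamped t x| <= K.
Proof.
apply: contrapT => nbnd.
have bad (n : nat) : exists p : R * R, n.+1%:R < `|clamped p.1 p.2|.
  apply: contrapT => nbad; apply: nbnd; exists n.+1%:R => // t x.
  by rewrite leNgt; apply/negP => h; apply: nbad; exists (t, x).
have [p pP] := choice bad.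
have [U [UU ooU]] := ultraFilterLemma (@eventually_filter).
have UP : ProperFilter U by exact: ultra_proper.
have [s [y [_ _ _ fsy]]] := clamped_cvg UU (fun n => (p n).1) (fun n => (p n).2).
pose m := Num.truncn (`|f s y| + 1).
have mlt : `|f s y| + 1 < m.+1%:R.
  by have /truncn_itv/andP[] : 0 <= `|f s y| + 1 by rewrite addr_ge0.
have lt1 : `|f s y| < `|f s y| + 1 by rewrite ltrDl.
have bnd : \forall n \near U, `|clamped (p n).1 (p n).2| <= `|f s y| + 1.
  by apply: cvgr_norm_le lt1.
have [n [nb mn]] : exists n, `|clamped (p n).1 (p n).2| <= `|f s y| + 1 /\ (m <= n)%N.
  by apply: (@filter_ex _ U); apply: filterI => //; apply: ooU; exists m.
have mn' : m.+1%:R <= n.+1%:R :> R by rewrite ler_nat ltnS.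
by have := lt_le_trans (lt_trans (lt_le_trans mlt mn') (pP n)) nb; rewrite ltxx.
Qed.

End clamped_field.

(** * Derivatives from first-order expansions *)

Section derivative_on_unit_interval.
Variable R : realType.

Lemma deriv_on01_of_expansion (x x' : R -> R) :
  (forall t e : R, 0 <= t <= 1 -> 0 < e -> exists2 d : R, 0 < d &
    forall s, 0 <= s <= 1 -> `|s - t| <= d ->
      `|x s - x t - (s - t) * x' t| <= e * `|s - t|) ->
  deriv_on01 x x'.
Proof.
move=> expn t t01; apply/cvgrPdist_le => e e0.
have [d d0 xd] := expn t e t01 e0.
rewrite /prop_near1 /within /dnbhs /within /=.
apply/nbhs_ballP; exists d => //= s; rewrite /ball /= => std sneq s01.
have st0 : s - t != 0 by rewrite subr_eq0.
have -> : x' t - (x s - x t) / (s - t) =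
    - ((x s - x t - (s - t) * x' t) / (s - t)) by field.
rewrite normrN normrM normfV ler_pdivrMr ?normr_gt0 //.
by apply: xd => //; rewrite distrC ltW.
Qed.

End derivative_on_unit_interval.

(** * Stieltjes integrals obtained from grid sums *)

Section stieltjes_limit.
Variable R : realType.
Implicit Types F T x : R -> R.

Definition increments_dominated F T :=
  forall s t, 0 <= s -> s <= t -> t <= 1 -> `|F t - F s| <= T t - T s.

(** [T t] is the variation over [[0, t]]; by additivity its increments are the variations over
    subintervals. *)
Lemma total_variation_dominates F : bounded_variation 0 1 F ->
  exists T : R -> R, increments_dominated F T /\
    T 1 - T 0 = fine (total_variation 0 1 F).
Proof.
move=> bvF; exists (fun t => fine (total_variation 0 t F)); split; last first.
  by rewrite total_variationxx subr0.
move=> s t s0 st t1.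
have tv_fin a b : 0 <= a -> a <= b -> b <= 1 -> total_variation a b F \is a fin_num.
  move=> a0 ab b1; apply/bounded_variationP => //.
  apply: (@bounded_variationl _ a b 1) => //.
  by apply: (@bounded_variationr _ 0 a 1) => //; exact: le_trans b1.
have t0 := le_trans s0 st; have s1 := le_trans st t1.
rewrite (total_variationD F s0 st) fineD ?tv_fin // addrAC subrr add0r.
by rewrite -lee_fin fineK ?tv_fin // total_variation_ge.
Qed.

Definition grid (n k : nat) : R := k%:R * n.+1%:R^-1.

Definition grid_sum (u : nat -> R) F n : R :=
  \sum_(0 <= k < n.+1) u k * (F (grid n k.+1) - F (grid n k)).

Lemma grid0 n : grid n 0 = 0. Proof. by rewrite /grid mul0r. Qed.

Lemma gridn n : grid n n.+1 = 1. Proof. by rewrite /grid mulfV ?pnatr_eq0. Qed.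

Lemma grid_ge0 n k : 0 <= grid n k. Proof. by rewrite mulr_ge0. Qed.

Lemma grid_leS n k : grid n k <= grid n k.+1.
Proof. by rewrite ler_wpM2r // ler_nat. Qed.

Lemma grid_le1 n k : (k <= n.+1)%N -> grid n k <= 1.
Proof. by move=> kn; rewrite /grid ler_pdivrMr ?ltr0n // mul1r ler_nat. Qed.

Lemma gridS n k : grid n k.+1 = grid n k + n.+1%:R^-1.
Proof. by rewrite /grid -natr1 mulrDl mul1r. Qed.

Lemma normr_grid_sum_le F T u n : increments_dominated F T ->
  (forall k, (k <= n)%N -> `|u k| <= 1) -> `|grid_sum u F n| <= T 1 - T 0.
Proof.
move=> FT u1; rewrite -(gridn n) -(grid0 n) -(telescope_sumr (fun k => T (grid n k))) //.
apply: (le_trans (ler_norm_sum _ _ _)).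
rewrite big_nat_cond [leRHS]big_nat_cond; apply: ler_sum => k /andP[/andP[_ kn] _].
rewrite normrM -[leRHS]mul1r ler_pM ?u1 //.
by rewrite FT ?grid_ge0 ?grid_leS ?grid_le1.
Qed.

Lemma ucont2_sum (X : R -> R -> nat -> R) (w : nat -> R) m :
  (forall k, ucont2 (fun a c => X a c k)) ->
  ucont2 (fun a c => \sum_(0 <= k < m) X a c k * w k).
Proof.
move=> uX; elim: m => [|m IH].
  move=> e e0; exists e => // a b a' b' _ _.
  by rewrite !big_geq // subrr normr0 ltW.
have -> : (fun a c => \sum_(0 <= k < m.+1) X a c k * w k) =
  (fun a c => \sum_(0 <= k < m) X a c k * w k + w m * X a c m).
  by apply/funext => a; apply/funext => c; rewrite big_nat_recr //= [X in _ + X]mulrC.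
by apply: ucont2D => //; exact: ucont2M.
Qed.

Lemma cell_dist (g h a y b d : R) : g < b -> a < g + h -> a <= y -> y <= b ->
  b - a < d -> h <= d -> `|g - y| <= 2 * d.
Proof. by move=> *; rewrite ler_norml; apply/andP; split; lra. Qed.

(** Every fine tagged sum is compared with one good grid sum, so existence and value of the integral
    come together. *)
Lemma RS_integral_of_grid_sums F T x (I : R) :
  increments_dominated F T ->
  (forall s t : R, 0 <= s <= 1 -> 0 <= t <= 1 -> `|x s - x t| <= `|s - t|) ->
  (forall e : R, 0 < e -> exists n u, [/\ n.+1%:R^-1 <= e,
     forall k, (k <= n.+1)%N -> `|u k - x (grid n k)| <= e &
     `|grid_sum u F n - I| <= e]) ->
  RS_integral 0 1 x F I.
Proof.
move=> FT lip approx e e0.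
have W0 : 0 <= T 1 - T 0 by apply: le_trans (FT _ _ (lexx 0) ler01 (lexx 1)).
set W := T 1 - T 0 in W0 *.
have K0 : 0 < 4 * (W + 1) by lra.
(* The final error is [3 * e' * W + e'], which is below [4 * e' * (W + 1) = e]. *)
pose e' := e / (4 * (W + 1)); have e'0 : 0 < e' by rewrite divr_gt0.
have e'E : 4 * (e' * (W + 1)) = e by rewrite /e'; field; lra.
have [n [u [hn ux uI]]] := approx e' e'0.
exists e' => // s xi [part [xis tag]] mesh.
pose q j := nth 1 (0 :: s) j.
have q0 : q 0%N = 0 by [].
have qn : q (size s) = 1 by rewrite /q (itv_partition_nth_size _ part).
have qle j : (j < size s)%N -> 0 <= q j /\ q j <= q j.+1 /\ q j.+1 <= 1.
  move=> js; split; first by apply: itv_partition_nth_ge part; rewrite ltnW.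
  split; last by apply: itv_partition_nth_le part.
  by have /andP[h1 h2] := tag j js; exact: le_trans h2.
have FT' y z : 0 <= y -> y <= z -> z <= 1 -> `|F z - F y| <= T z - T y by exact: FT.
(* One [e'] is the error of [u] at a node, and [2 * e'] bounds the distance from that node to the
   tag of an overlapping cell. *)
have cmp : `|grid_sum u F n - RS_sum 0 1 x F s xi| <= 3 * e' * W.
  apply: (stieltjes_sum_compare (l := 0) (r := 1) (p := grid n) (q := q)
    (v := fun j => x (nth 1 xi j)) (T := T)) => //.
  - exact: grid0.
  - exact: gridn.
  - by move=> k kn; rewrite grid_ge0 grid_leS grid_le1.
  move=> k j kn js kq qk.
  have [qj0 [_ qj1]] := qle j js; have /andP[h1 h2] := tag j js.
  have dist : `|grid n k - nth 1 xi j| <= 2 * e'.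
    by apply: (cell_dist kq _ h1 h2 (mesh j js) hn); rewrite -gridS.
  apply: (distr_le_triangle (ux k (ltnW kn)) (lip _ _ _ _)).
  - by rewrite grid_ge0 grid_le1 // ltnW.
  - by rewrite (le_trans qj0 h1) (le_trans h2 qj1).
  - lra.
apply: (@le_lt_trans _ _ (3 * e' * W + e')); last by nra.
by apply: (distr_le_triangle _ uI (lexx _)); rewrite distrC.
Qed.

End stieltjes_limit.

(** * Approximate boundary conditions and the passage to a solution *)

Section boundary_value_problem.
Variable R : realType.

(** A fixed point has [a = S_A] and [x(1) = a - S_D], which for [D = A - B] says [x(1) = S_B].
    Subtracting the conditions makes the variation of [A - B] the one that matters. *)
Lemma euler_approximate_boundary (phi : R -> R -> R) (A D TA TD : R -> R) (M : R) (n : nat) :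
  ucont2 phi -> (forall t x, `|phi t x| <= M) ->
  increments_dominated A TA -> increments_dominated D TD ->
  (TA 1 - TA 0) + (TD 1 - TD 0) + 2 * M <= 1 ->
  exists p : R * R, let X := euler_pos phi n.+1%:R^-1 p.1 p.2 in
    [/\ `|p.1| + `|p.2| + M <= 1, `|grid_sum X A n - X 0%N| <= n.+1%:R^-1 &
        `|X 0%N - grid_sum X D n - X n.+1| <= n.+1%:R^-1].
Proof.
move=> uphi phiM domA domD small.
have M0 : 0 <= M by apply: le_trans (phiM 0 0).
have A0 : 0 <= TA 1 - TA 0 by apply: le_trans (domA _ _ (lexx 0) ler01 (lexx 1)).
have D0 : 0 <= TD 1 - TD 0 by apply: le_trans (domD _ _ (lexx 0) ler01 (lexx 1)).
set vA := TA 1 - TA 0 in small A0 *; set vD := TD 1 - TD 0 in small D0 *.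
have h0 : 0 < n.+1%:R^-1 :> R by rewrite invr_gt0.
set h : R := n.+1%:R^-1 in h0 *.
pose F a c := grid_sum (euler_pos phi h a c) A n.
pose G a c := a + c - euler_pos phi h a c n.+1 - grid_sum (euler_pos phi h a c) D n.
have uX k : ucont2 (fun a c => euler_pos phi h a c k) by case: (ucont2_euler h k uphi).
have uF : ucont2 F by exact: ucont2_sum.
have uG : ucont2 G.
  have -> : G = (fun a c => (a + c) + (-1 * euler_pos phi h a c n.+1 +
      -1 * grid_sum (euler_pos phi h a c) D n)).
    by apply/funext => a; apply/funext => c; rewrite /G; ring.
  apply: ucont2D.
    by apply: ucont2D => e e0; exists e.
  by apply: ucont2D; apply: ucont2M => //; exact: ucont2_sum.
(* On this rectangle positions are at most [vA + vD + 2 * M <= 1], so the Stieltjes sums are bounded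
   by the variations; the extra [M] in the second side pays for the end position against [a + c]. *)
have self a c : `|a| <= vA -> `|c| <= vD + M -> `|F a c| <= vA /\ `|G a c| <= vD + M.
  move=> avA cvD.
  have X1 k : (k <= n)%N -> `|euler_pos phi h a c k| <= 1.
    move=> kn; have kh : k%:R * h <= 1 by rewrite grid_le1 // leqW.
    have [_] := euler_position_bound a c (ltW h0) phiM kh.
    by move=> /le_trans; apply; lra.
  split; first exact: normr_grid_sum_le.
  have nh : n.+1%:R * h = 1 by exact: gridn.
  have nh1 : n.+1%:R * h <= 1 by rewrite nh.
  have [+ _] := euler_position_bound a c (ltW h0) phiM nh1.
  rewrite nh mul1r => XM; have SD := normr_grid_sum_le domD X1.
  have -> : G a c = - (euler_pos phi h a c n.+1 - a - c) -
    grid_sum (euler_pos phi h a c) D n by rewrite /G; ring.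
  by rewrite (le_trans (ler_normB _ _)) // normrN addrC lerD.
have [|a [c [avA cvD Fa Gc]]] := approximate_fixed_point A0 _ uF uG self h0.
  by rewrite addr_ge0.
exists (a, c) => /=; split => //; first lra.
have -> : euler_pos phi h a c 0 = a by [].
suff -> : a - grid_sum (euler_pos phi h a c) D n - euler_pos phi h a c n.+1 = G a c - c by [].
by rewrite /G; ring.
Qed.

Lemma bounded_variation_sub (F G : R -> R) : bounded_variation 0 1 F ->
  bounded_variation 0 1 G -> bounded_variation 0 1 (fun t => F t - G t).
Proof.
move=> bvF bvG; have : bounded_variation 0 1 (F \+ (\- G)).
  by apply: bounded_variationD => //; exact: bounded_variationN.
by [].
Qed.

End boundary_value_problem.

Theorem theorem4p17 (R : realType) (f : R -> R -> R) (A B : R -> R) :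
  {within [set p : R * R | 0 <= p.1 <= 1], continuous (fun p : R * R => f p.1 p.2)} ->
  bounded_variation 0 1 A -> bounded_variation 0 1 B ->
  (total_variation 0 1 A + total_variation 0 1 (fun t => A t - B t)%R < 1%:E)%E ->
  exists2 lambda0 : R, 0 < lambda0 &
    forall lambda : R, `|lambda| <= lambda0 ->
      exists x : R -> R, is_solution f A B lambda x.
Proof.
move=> cf bvA bvB var_lt1; have bvD := bounded_variation_sub bvA bvB.
have [TA [domA TA1]] := total_variation_dominates bvA.
have [TB [domB _]] := total_variation_dominates bvB.
have [TD [domD TD1]] := total_variation_dominates bvD.
have {var_lt1} var_lt1 : (TA 1 - TA 0) + (TD 1 - TD 0) < 1.
  by rewrite TA1 TD1 -lte_fin EFinD !fineK //; apply/bounded_variationP.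
have [K K0 fK] := clamped_bounded cf.
(* This is the largest bound giving [(TA 1 - TA 0) + (TD 1 - TD 0) + 2 * M <= 1] with [M] equal to
   [|lambda| * K]. *)
exists ((1 - ((TA 1 - TA 0) + (TD 1 - TD 0))) / (2 * K)).
  by rewrite divr_gt0 ?mulr_gt0 // subr_gt0.
move=> lambda; rewrite ler_pdivlMr ?mulr_gt0 // => lambdaK.
pose phi t x := - lambda * clamped f t x; pose M := `|lambda| * K.
have uphi : ucont2 phi by apply: ucont2M; exact: ucont2_clamped.
have phiM t x : `|phi t x| <= M by rewrite normrM normrN ler_wpM2l.
have small : (TA 1 - TA 0) + (TD 1 - TD 0) + 2 * M <= 1.
  by move: lambdaK; rewrite /M mulrCA; lra.
have [p pP] := choice (fun n => euler_approximate_boundary n uphi phiM domA domD small).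
have acM n : `|(p n).1| + `|(p n).2| + M <= 1 by case: (pP n).
have [x [v [xv vphi x1 lip approx]]] := euler_limit uphi phiM acM.
have M0 : 0 <= M by rewrite mulr_ge0 // ltW.
(* The limit [x] is controlled on [[0, 1]] only; the inner clamp makes the second derivative
   continuous on the whole line. *)
exists x, v, (fun t => phi t (x (clamp 0 1 t))); split.
- apply: deriv_on01_of_expansion => t e t01 e0.
  (* The remainder is [2 * M * (s - t) ^ 2]; the summand 1 covers [M = 0]. *)
  exists (e / (2 * M + 1)) => [|s s01 std]; first by rewrite divr_gt0 //; lra.
  apply: (le_trans (xv s t s01 t01)).
  rewrite -real_normK ?num_real // expr2 mulrA ler_wpM2r //.
  move: std; rewrite ler_pdivlMr; last lra.
  by move: (normr_ge0 (s - t)) => ? ?; nra.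
- apply: deriv_on01_of_expansion => t e t01 e0.
  have [d d0 vd] := vphi e e0; exists d => // s s01 std.
  by rewrite clamp_id //; exact: vd.
- apply: continuous_subspaceT => t; apply/cvgrPdist_le => e e0.
  have [d d0 phid] := uphi e e0.
  near=> s.
  have ts : `|t - s| <= d by near: s; exact: cvgr_dist_le d0.
  apply: phid => //; apply: le_trans ts.
  by apply: le_trans (lip _ _ _ _) (clamp_lipschitz _ _ _ _); exact: clamp_itv.
(* Since [|x t| <= 1], both clamps are identities and the original equation is recovered. *)
- move=> t t01; rewrite /phi /clamped !clamp_id //.
  by rewrite -ler_norml x1.
have near_solution e : 0 < e -> exists n, [/\ n.+1%:R^-1 <= e :> R &
    forall k, (k <= n.+1)%N ->
      `|euler_pos phi n.+1%:R^-1 (p n).1 (p n).2 k - x (grid R n k)| <= e].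
  move=> e0; have [m hm] := exists_small_inverse e0.
  have [n mn xn] := approx e m e0; exists n; split => //.
  by apply: le_trans hm; rewrite lef_pV2 ?posrE ?ltr0n // ler_nat.
split.
- apply: (RS_integral_of_grid_sums domA lip) => e e0.
  have [|n [hn Xx]] := near_solution (e / 2); first lra.
  exists n, (euler_pos phi n.+1%:R^-1 (p n).1 (p n).2); split.
  + by apply: (le_trans hn); lra.
  + by move=> k /Xx /le_trans; apply; lra.
  have [_ XA _] := pP n; have X0 := Xx 0%N isT; rewrite grid0 in X0.
  by apply: (distr_le_triangle XA X0); rewrite [leRHS]splitr lerD2r.
- apply: (RS_integral_of_grid_sums domB lip) => e e0.
  (* One third for each of the two approximate boundary conditions, whose sum is the condition for
     [B], and one for the distance from the scheme to [x] at 1. *)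
  have [|n [hn Xx]] := near_solution (e / 3); first lra.
  set X := euler_pos phi n.+1%:R^-1 (p n).1 (p n).2 in Xx.
  exists n, X; split.
  + by apply: (le_trans hn); lra.
  + by move=> k /Xx /le_trans; apply; lra.
  have [_ XA XD] := pP n; rewrite -/X in XA XD.
  have X1 := Xx n.+1 (leqnn _); rewrite gridn in X1.
  have BE : grid_sum X B n =
      grid_sum X A n - grid_sum X (fun t => A t - B t) n.
    by rewrite /grid_sum -sumrB; apply: eq_bigr => k _; ring.
  have XB : `|grid_sum X B n - X n.+1| <= e / 3 + e / 3.
    have -> : grid_sum X B n - X n.+1 = (grid_sum X A n - X 0%N) +
       (X 0%N - grid_sum X (fun t => A t - B t) n - X n.+1) by rewrite BE; ring.
    by rewrite (le_trans (ler_normD _ _)) // lerD // (le_trans _ hn).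
  by apply: (distr_le_triangle XB X1); lra.
Unshelve. all: by end_near. Qed.
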